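(* Let $d,m$ be positive integers, let $p$ be a prime number, put $n=p^m$ and assume $1\le d\le n$. Then the following hold: (1) For every $p$-monotone Ferrers diagram $\mathcal{D}$ of order $n$ and every finite field $\mathbb{F}$ of characteristic $p$, there exists a $[\mathcal{D},\nu_{\min}(\mathcal{D},d),d]_{\mathbb{F}}$ code. (2) For every $p$-convex Ferrers diagram $\mathcal{D}$ of order $n$ and every finite field $\mathbb{F}$ of characteristic $p$, there exists a $[\mathcal{D},\nu_{\min}(\mathcal{D},d),d]_{\mathbb{F}}$ code.
   Context: Write $[n]=\{1,\ldots,n\}$. A (top-right justified) Ferrers diagram of order $n$ is a subset $\mathcal{D}\subseteq[n]^2$ such that: if $(i,j)\in\mathcal{D}$ and $j\le j'\le n$, then $(i,j')\in\mathcal{D}$; and if $(i,j)\in\mathcal{D}$ and $1\le i'\le i$, then $(i',j)\in\mathcal{D}$. It is identified with the vector $(c_1,\ldots,c_n)$, $c_j=|\{i\in[n]:(i,j)\in\mathcal{D}\}|$, so $0\le c_1\le\cdots\le c_n\le n$ and $\mathcal{D}=\{(i,j)\in[n]^2: i\le c_j\}$. For a field $\mathbb{F}$, $\mathbb{F}^{\mathcal{D}}$ is the space of matrices $(a_{i,j})\in\mathbb{F}^{n\times n}$ with $a_{i,j}=0$ for all $(i,j)\notin\mathcal{D}$. A $[\mathcal{D},k,d]_{\mathbb{F}}$ (Ferrers diagram rank-metric) code is a $k$-dimensional $\mathbb{F}$-subspace $\mathcal{C}\subseteq\mathbb{F}^{\mathcal{D}}$ whose minimum rank distance $\min\{\operatorname{rk}(A):A\in\mathcal{C},A\ne0\}$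 equals $d$. (Convention: for $k=0$ the zero subspace counts as a $[\mathcal{D},0,d]_{\mathbb{F}}$ code.) Define $$\nu_{\min}(\mathcal{D},d)=\min_{0\le j\le d-1}\ \sum_{i=1}^{n-j}\max\{0,c_i-d+1+j\}.$$ A Ferrers diagram $(c_1,\ldots,c_n)$ is monotone if for every $i\in\{1,\ldots,n-1\}$ with $0<c_i<n$ one has $c_{i+1}>c_i$. It is convex if $c_{i+1}-c_i\le1$ for every $i\in\{1,\ldots,n-1\}$. For a prime $p$, the $p$-height of $\mathcal{D}=(c_1,\ldots,c_n)$ is the largest integer $h\ge0$ such that: (i) $p^h\mid n$; (ii) $p^h\mid c_i$ for all $i\in[n]$; (iii) whenever $r,s\in\{0,\ldots,n-1\}$ both lie in $\{Qp^h,Qp^h+1,\ldots,(Q+1)p^h-1\}$ for some integer $Q\ge0$, one has $c_{n-r}=c_{n-s}$. The $p$-contraction of $\mathcal{D}$ is the Ferrers diagram $\mathcal{D}^{(p)}=(c_1',\ldots,c'_{n/p^h})$ of order $n/p^h$ with $c_i'=c_{p^hi}/p^h$. The diagram $\mathcal{D}$ is $p$-monotone (resp. $p$-convex) if $\mathcal{D}^{(p)}$ is monotone (resp. convex) as a Ferrers diagram of order $n/p^h$. *)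

(* Defs.v *)
From HB Require Import structures.
From mathcomp Require Import all_boot all_order all_algebra.

Set Implicit Arguments.
Unset Strict Implicit.
Unset Printing Implicit Defensive.

Import GRing.Theory.

Local Open Scope nat_scope.

(* A cell of [n]^2 is a pair (row, column) of 0-based ordinals; the first     *)
(* component indexes rows (from the top), the second columns (from the left). *)
Definition ferrers (n : nat) (D : {set 'I_n * 'I_n}) : Prop :=
  (forall i j j' : 'I_n, (i, j) \in D -> j <= j' -> (i, j') \in D) /\
  (forall i i' j : 'I_n, (i, j) \in D -> i' <= i -> (i', j) \in D).

(* Column heights c_j are indexed from 1, and c_j = 0 unless 1 <= j <= n.     *)
Definition colh (n : nat) (D : {set 'I_n * 'I_n}) (j : nat) : nat :=
  #|[set x in D | (x.2 : nat).+1 == j]|.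

(* As j <= d - 1, the truncated difference c_i + (j + 1) - d is               *)
(* max(0, c_i - d + 1 + j).                                                   *)
Definition nu (n : nat) (D : {set 'I_n * 'I_n}) (d j : nat) : nat :=
  \sum_(1 <= i < (n - j).+1) (colh D i + j.+1 - d).

(* For d > 0 the unit nu D d 0 is itself one of the terms of the minimum.     *)
Definition nu_min (n : nat) (D : {set 'I_n * 'I_n}) (d : nat) : nat :=
  \big[minn/nu D d 0]_(j < d) nu D d j.

Definition monotone_diagram (n : nat) (D : {set 'I_n * 'I_n}) : Prop :=
  forall i : nat, 1 <= i < n -> 0 < colh D i < n -> colh D i < colh D i.+1.

Definition convex_diagram (n : nat) (D : {set 'I_n * 'I_n}) : Prop :=
  forall i : nat, 1 <= i < n -> colh D i.+1 <= colh D i + 1.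

Definition height_cond (p n : nat) (D : {set 'I_n * 'I_n}) (h : nat) : bool :=
  [&& p ^ h %| n,
      [forall i : 'I_n, p ^ h %| colh D i.+1]
    & [forall Q : 'I_n, forall r : 'I_n, forall s : 'I_n,
        (Q * p ^ h <= r < Q.+1 * p ^ h) && (Q * p ^ h <= s < Q.+1 * p ^ h)
          ==> (colh D (n - r) == colh D (n - s))]].

Lemma height_condP (p n : nat) (D : {set 'I_n * 'I_n}) (h : nat) : 0 < p ->
  reflect
    [/\ p ^ h %| n,
        forall i, 1 <= i <= n -> p ^ h %| colh D i
      & forall r s Q, r < n -> s < n ->
          Q * p ^ h <= r < Q.+1 * p ^ h -> Q * p ^ h <= s < Q.+1 * p ^ h ->
          colh D (n - r) = colh D (n - s)]
    (height_cond p D h).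
Proof.
move=> p_gt0; apply: (iffP and3P) => -[pn pc blk]; split=> //.
- by case=> // i lt_in; apply: (forallP pc (Ordinal lt_in)).
- move=> r s Q lt_rn lt_sn Qr Qs.
  have lt_Qn : Q < n.
    apply: leq_ltn_trans lt_rn; case/andP: Qr => + _; apply: leq_trans.
    by rewrite leq_pmulr // expn_gt0 p_gt0.
  move/forallP/(_ (Ordinal lt_Qn))/forallP/(_ (Ordinal lt_rn)): blk.
  by move/forallP/(_ (Ordinal lt_sn)); rewrite /= Qr Qs => /eqP.
- by apply/forallP => i; apply: pc; rewrite /= ltn_ord.
- apply/forallP => Q; apply/forallP => r; apply/forallP => s.
  by apply/implyP => /andP[Qr Qs]; apply/eqP; apply: (blk r s Q).
Qed.

(* The bound h <= n loses nothing: p ^ h %| n forces h < p ^ h <= n when      *)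
(* p > 1 and n > 0 (see pheightP).                                            *)
Definition pheight (p n : nat) (D : {set 'I_n * 'I_n}) : nat :=
  \max_(h < n.+1 | height_cond p D h) h.

Lemma pheightP (p n : nat) (D : {set 'I_n * 'I_n}) : 1 < p -> 0 < n ->
  height_cond p D (pheight p D) /\
  forall h, height_cond p D h -> h <= pheight p D.
Proof.
move=> p_gt1 n_gt0; have p_gt0 : 0 < p by apply: ltnW.
split; last first.
  move=> h Hh; have lt_hn : h < n.+1.
    have /height_condP-/(_ p_gt0)[pn _ _] := Hh.
    by rewrite ltnW // ltnS (leq_trans (ltn_expl h p_gt1)) // dvdn_leq.
  exact: (leq_bigmax_cond (F := fun i : 'I_n.+1 => i : nat) (Ordinal lt_hn)).
have H0 : height_cond p D (@ord0 n).
  apply/height_condP=> //=; rewrite expn0; split=> // r s Q _ _.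
  by rewrite !muln1 !ltnS -!eqn_leq => /eqP <- /eqP <-.
rewrite /pheight.
have ne : 0 < #|[pred h : 'I_n.+1 | height_cond p D h]|.
  by apply/card_gt0P; exists ord0.
by have [h Hh ->] := eq_bigmax_cond (fun h : 'I_n.+1 => h : nat) ne.
Qed.

Definition contraction (p n : nat) (D : {set 'I_n * 'I_n}) :
    {set 'I_(n %/ p ^ pheight p D) * 'I_(n %/ p ^ pheight p D)} :=
  let q := p ^ pheight p D in
  [set x : 'I_(n %/ q) * 'I_(n %/ q) | x.1 < colh D (q * x.2.+1) %/ q].

Lemma colhE (n : nat) (D : {set 'I_n * 'I_n}) (j : 'I_n) :
  colh D j.+1 = #|[set i : 'I_n | (i, j) \in D]|.
Proof.
have inj : injective (fun i : 'I_n => (i, j)) by move=> a b [].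
rewrite -(card_imset _ inj); apply: eq_card => -[a b].
rewrite !inE /= eqSS; apply/andP/imsetP => [[abD /eqP/val_inj bj]|[i]].
  by exists a; rewrite ?inE -bj.
by rewrite inE => ijD [-> ->].
Qed.

Lemma colh_leq (n : nat) (D : {set 'I_n * 'I_n}) (j : nat) : colh D j <= n.
Proof.
case: j => [|j]; first by rewrite /colh eq_card0 // => x; rewrite !inE andbF.
have [lt_j|le_j] := ltnP j n.
  by rewrite (colhE _ (Ordinal lt_j)) -[leqRHS]card_ord max_card.
rewrite /colh eq_card0 // => x; rewrite !inE eqSS.
by rewrite (ltn_eqF (leq_trans (ltn_ord _) le_j)) andbF.
Qed.

Lemma colh_contraction (p n : nat) (D : {set 'I_n * 'I_n}) (i : nat) :
  1 <= i <= n %/ p ^ pheight p D ->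
  colh (contraction p D) i =
    colh D (p ^ pheight p D * i) %/ p ^ pheight p D.
Proof.
case: i => // i /= lt_i; rewrite (colhE _ (Ordinal lt_i)).
set k := RHS.
have le_k : k <= n %/ p ^ pheight p D by apply/leq_div2r/colh_leq.
have inj : injective (widen_ord le_k).
  by move=> a b /(congr1 val) /= /val_inj.
rewrite -[RHS]card_ord -(card_imset _ inj).
apply: eq_card => a; rewrite !inE /=; apply/idP/imsetP => [lt_a|[b _ ->]].
  by exists (Ordinal lt_a) => //; apply: val_inj.
exact: (ltn_ord b).
Qed.

Lemma ferrers_contraction (p n : nat) (D : {set 'I_n * 'I_n}) :
  ferrers D -> ferrers (contraction p D).
Proof.
case=> Dr _; split=> [i j j'|i i' j]; rewrite !inE /=; last first.
  by move=> lt_i le_i; apply: leq_ltn_trans lt_i.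
move=> lt_i le_j; apply: leq_trans lt_i _; apply: leq_div2r.
set q := p ^ pheight p D in j j' le_j *.
have [q0|q_gt0] := posnP q.
  by move: (j : nat) (j' : nat) => a b; rewrite q0 !mul0n.
have bnd (k : 'I_(n %/ q)) : (q * k.+1).-1 < n.
  rewrite prednK ?muln_gt0 ?q_gt0 // mulnC.
  by rewrite (leq_trans _ (leq_divM n q)) // leq_mul2r ltn_ord orbT.
have colhq (k : 'I_(n %/ q)) : colh D (q * k.+1) =
    #|[set i : 'I_n | (i, Ordinal (bnd k)) \in D]|.
  by rewrite -colhE /= prednK // muln_gt0 q_gt0.
rewrite !colhq; apply/subset_leq_card/subsetP => x; rewrite !inE => xD.
by apply: Dr xD _; rewrite /= -!subn1 leq_sub2r // leq_mul2l ltnS le_j orbT.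
Qed.

Definition pmonotone (p n : nat) (D : {set 'I_n * 'I_n}) : Prop :=
  monotone_diagram (contraction p D).

Definition pconvex (p n : nat) (D : {set 'I_n * 'I_n}) : Prop :=
  convex_diagram (contraction p D).

Local Open Scope ring_scope.

Definition supported_on (F : fieldType) (n : nat) (D : {set 'I_n * 'I_n})
    (A : 'M[F]_n) : Prop :=
  forall i j : 'I_n, (i, j) \notin D -> A i j = 0.

Definition min_rank_distance (F : fieldType) (n : nat) (C : {vspace 'M[F]_n})
    (d : nat) : Prop :=
  (exists A : 'M[F]_n, [/\ A \in C, A != 0 & \rank A = d]) /\
  (forall A : 'M[F]_n, A \in C -> A != 0 -> (d <= \rank A)%N).

(* [D, k, d]_F codes; for k = 0 the zero subspace qualifies for every d.      *)
Definition ferrers_code (F : fieldType) (n : nat) (D : {set 'I_n * 'I_n})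
    (k d : nat) (C : {vspace 'M[F]_n}) : Prop :=
  [/\ forall A : 'M[F]_n, A \in C -> supported_on D A,
      \dim C = k
    & k = 0%N \/ min_rank_distance C d].

(* Main.v *)
Require Import Defs.
From HB Require Import structures.
From mathcomp Require Import all_boot all_order all_algebra.
From mathcomp Require Import all_fingroup all_field zify ring.

(* Let L/F be the extension of degree n = p^m, s its Frobenius automorphism and
   delta = s - 1.  As (s - 1)^(p^h) = s^(p^h) - 1, delta is nilpotent and the
   kernels V_i of delta^i form a full flag of L.  A matrix in a basis adapted to
   the flag is supported on D iff the endomorphism maps V_j into V_(c_j) for all
   j, and a nonzero sum of a_i s^i (i <= n - d), being given by a polynomial of
   degree at most |F|^(n - d), has rank at least d.  With q = p^h, delta^q is a
   twisted derivation, so V_(qa) V_(qb) is contained in V_(q(a + b - 1)).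
   If D is p-monotone, the maps sum_i a_i delta^i with a_i in V_(c_(i+1)) form a
   code of dimension nu_(d-1); if D is p-convex, the maps x |-> sum_i
   delta^i(a_i x) with a_i in V_(r_i), r_i the length of row n - i of D, form a
   code of dimension nu_0.  The Singleton-type bound dim C <= nu_j, applied for
   d and for d + 1, shows that the dimension is nu_min and d is attained. *)

Set Implicit Arguments.
Unset Strict Implicit.
Unset Printing Implicit Defensive.

Import GRing.Theory FalgLfun.

Local Open Scope nat_scope.

(** * The Singleton-type bound *)

Lemma sum_ord_interval (n a b : nat) :
  b <= n -> \sum_(i < n) ((a <= i) && (i < b)) = b - a.
Proof.
elim: n b => [|n IH] b; first by rewrite leqn0 => /eqP ->; rewrite big_ord0.
rewrite big_ord_recr /= leq_eqVlt => /orP[/eqP ->|]; last first.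
  rewrite ltnS => lt_bn.
  by rewrite IH // [n < b]ltnNge lt_bn andbF addn0.
have -> : \sum_(i < n) ((a <= i) && (i < n.+1)) = n - a.
  rewrite -(IH n) //; apply: eq_bigr => i _.
  by rewrite ltnS ltn_ord (ltnW (ltn_ord i)).
by rewrite ltnSn andbT; case: leqP => /=; lia.
Qed.

(** Each column is an initial segment: a cell in row [i] forces at least [i + 1] cells, and a
    missing one leaves at most [i]. *)
Lemma ferrersE (n : nat) (D : {set 'I_n * 'I_n}) (i j : 'I_n) :
  ferrers D -> ((i, j) \in D) = (i < colh D j.+1).
Proof.
case=> _ Dd; rewrite colhE -sum1dep_card big_mkcond /=.
have -> : \sum_(k < n) (if (k, j) \in D then 1 else 0)
          = \sum_(k < n) ((k, j) \in D : nat).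
  by apply: eq_bigr => k _; case: ifP.
have [ijD|ijD] := boolP ((i, j) \in D).
  rewrite -[i.+1]subn0 -(sum_ord_interval 0 (ltn_ord i)); apply/esym.
  apply: leq_sum => k _; rewrite ltnS /=; case: (leqP k i) => // le_ki.
  by rewrite (Dd _ _ _ ijD le_ki).
apply/esym/negbTE; rewrite -leqNgt -[leqRHS]subn0.
rewrite -(sum_ord_interval 0 (ltnW (ltn_ord i))); apply: leq_sum => k _ /=.
case: (ltnP k i) => [_|le_ik]; first by case: (_ \in D).
by rewrite leqn0 eqb0; apply: contra ijD => kjD; apply: Dd kjD _.
Qed.

Lemma colh_mono (n : nat) (D : {set 'I_n * 'I_n}) (i j : nat) :
  ferrers D -> i <= j <= n -> colh D i <= colh D j.
Proof.
case=> Dr _ /andP[]; case: i j => [|i] [|j] // le_ij lt_jn.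
  by rewrite [colh D 0]/colh eq_card0 // => x; rewrite !inE andbF.
have lt_in := leq_trans le_ij lt_jn.
rewrite (colhE D (Ordinal lt_in)) (colhE D (Ordinal lt_jn)).
by apply/subset_leq_card/subsetP => k; rewrite !inE => /Dr; apply.
Qed.

Lemma nuE (n : nat) (D : {set 'I_n * 'I_n}) (d j : nat) :
  nu D d j = \sum_(i < n - j) (colh D i.+1 + j.+1 - d).
Proof. by rewrite /nu big_add1 /= big_mkord. Qed.

(** Counting column by column: a column of height c has max(0, c - (d - 1 - j)) cells below its
    first d - 1 - j rows. *)
Lemma card_nu (n : nat) (D : {set 'I_n * 'I_n}) (d j : nat) :
    ferrers D -> j < d ->
  #|[set x in D | (d - j.+1 <= x.1) && (x.2 < n - j)]| = nu D d j.
Proof.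
move=> fD lt_jd; rewrite nuE -sum1dep_card big_mkcond /=.
rewrite (eq_bigr (fun x : 'I_n * 'I_n =>
    (x.2 < n - j) * ((d - j.+1 <= x.1) && (x.1 < colh D x.2.+1)))); last first.
  move=> [i k] _ /=; rewrite ferrersE //.
  by case: (i < _); case: (_ <= i); case: (k < _).
rewrite -(pair_bigA _ (fun i k : 'I_n =>
    (k < n - j) * ((d - j.+1 <= i) && (i < colh D k.+1)))) exchange_big /=.
under eq_bigr => k _ do rewrite -big_distrr /= sum_ord_interval ?colh_leq //.
rewrite (big_ord_widen n (fun i => colh D i.+1 + j.+1 - d)) ?leq_subr //.
rewrite [RHS]big_mkcond /=; apply: eq_bigr => k _.
case: ltnP => _ /=; lia.
Qed.

Lemma nu_min_leq (n : nat) (D : {set 'I_n * 'I_n}) (d j : nat) :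
  j < d -> nu_min D d <= nu D d j.
Proof.
move=> lt_jd; rewrite /nu_min; move: (mem_index_enum (Ordinal lt_jd)).
elim: (index_enum _) => //= k r IH; rewrite inE big_cons => /orP[/eqP <-|/IH].
  exact: geq_minl.
exact/leq_trans/geq_minr.
Qed.

Lemma nu_min_attained (n : nat) (D : {set 'I_n * 'I_n}) (d : nat) :
  0 < d -> exists2 j, j < d & nu_min D d = nu D d j.
Proof.
move=> d_gt0; rewrite /nu_min.
apply: (big_ind (fun x => exists2 j, j < d & x = nu D d j)).
- by exists 0.
- move=> _ _ [i lt_id ->] [j lt_jd ->].
  by rewrite /minn; case: ifP => _; [exists i | exists j].
- by move=> i _; exists i.
Qed.

Lemma mxrank_cross (F : fieldType) (n r j : nat) (A : 'M[F]_n) :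
    (forall i k : 'I_n, r <= i -> k < n - j -> A i k = 0%R) ->
  \rank A <= r + j.
Proof.
move=> A0; have [le_nr|/ltnW le_rn] := leqP n r.
  by rewrite (leq_trans (rank_leq_row _)) // (leq_trans le_nr) ?leq_addr.
(* The first summand keeps the first [r] rows; the second keeps the other rows, which live in the
   last [j] columns. *)
have -> : A = (pid_mx r *m A + copid_mx r *m A *m copid_mx (n - j))%R.
  rewrite {2}/copid_mx mulmxBr mulmx1.
  have -> : (copid_mx r *m A *m pid_mx (n - j) = 0 :> 'M_n)%R.
    apply/matrixP => i k; rewrite !mxE big1 // => l _; rewrite !mxE.
    case: (ltnP l (n - j)) => lj; rewrite ?andbF ?mulr0 //.
    rewrite andbT; apply/eqP; rewrite mulf_eq0; apply/orP; left; apply/eqP.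
    rewrite big1 // => u _; rewrite !mxE.
    have [lt_ur|le_ru] := ltnP u r; last by rewrite A0 ?mulr0.
    have [->|ne_iu] := eqVneq i u; first by rewrite eqxx lt_ur subrr mul0r.
    by rewrite -val_eqE in ne_iu; rewrite (negPf ne_iu) subr0 mul0r.
  by rewrite subr0 -mulmxDl addrC subrK mul1mx.
apply: leq_trans (mxrank_add _ _) (leq_add _ _).
  by rewrite (leq_trans (mxrankM_maxl _ _)) // rank_pid_mx.
rewrite (leq_trans (mxrankM_maxr _ _)) // rank_copid_mx ?leq_subr //.
by lia.
Qed.

Lemma singleton_bound (F : fieldType) (n : nat) (D : {set 'I_n * 'I_n})
    (C : {vspace 'M[F]_n}) (d j : nat) :
    ferrers D -> (forall A, A \in C -> supported_on D A) ->
    (forall A, A \in C -> A != 0%R -> d <= \rank A) -> j < d ->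
  \dim C <= nu D d j.
Proof.
move=> fD sC dC lt_jd; rewrite -(card_nu fD lt_jd).
(* A matrix of C vanishing on S lives in d - j - 1 rows and j columns, so its
   rank is less than d. *)
set S := [set x in D | _].
pose f (A : 'M[F]_n) : 'rV[F]_#|S| :=
  (\row_s A (enum_val s).1 (enum_val s).2)%R.
have f_lin : linear f by move=> a A B; apply/rowP => s; rewrite !mxE.
pose fM := GRing.isLinear.Build _ _ _ _ f f_lin.
pose fL : {linear 'M[F]_n -> 'rV[F]_#|S|} := HB.pack f fM.
have -> : \dim C = \dim (linfun fL @: C).
  apply/esym/limg_dim_eq/eqP; rewrite -subv0; apply/subvP => A.
  rewrite memv_cap memv_ker lfunE /= memv0 => /andP[AC /eqP/rowP fA0].
  apply/idPn => A_neq0; have := dC A AC A_neq0; apply/negP; rewrite -ltnNge.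
  have -> : d = (d - j.+1 + j).+1 by lia.
  rewrite ltnS; apply: mxrank_cross => i k le_i lt_k.
  have [ikD|/sC->//] := boolP ((i, k) \in D).
  have ikS : (i, k) \in S by rewrite inE ikD le_i.
  by have := fA0 (enum_rank_in ikS (i, k)); rewrite !mxE enum_rankK_in.
by rewrite (leq_trans (dimvS (subvf _))) // dimvf /dim /= mul1n.
Qed.

(** Every positive term of the sum drops by one when [d] becomes [d + 1]. This rules out a code of
    dimension [nu D d j > 0] whose nonzero elements all have rank above [d]. *)
Lemma nu_succ_lt (n : nat) (D : {set 'I_n * 'I_n}) (d j : nat) :
  j < d -> 0 < nu D d j -> nu D d.+1 j < nu D d j.
Proof.
move=> lt_jd; rewrite !nuE.
have le_sum (N : nat) : \sum_(i < N) (colh D i.+1 + j.+1 - d.+1) <=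
    \sum_(i < N) (colh D i.+1 + j.+1 - d).
  by apply: leq_sum => i _; rewrite leq_sub2l.
elim: (n - j) => [|N IH]; first by rewrite big_ord0.
rewrite !big_ord_recr /=; move: (le_sum N) IH.
move: (\sum_(i < N) _) (\sum_(i < N) _) => a b; lia.
Qed.

(** Leaves only a lower bound on the dimension to be proved for each construction. *)
Lemma ferrers_code_of_dim_geq (F : finFieldType) (n : nat)
    (D : {set 'I_n * 'I_n}) (C : {vspace 'M[F]_n}) (d : nat) :
    0 < d -> ferrers D -> (forall A, A \in C -> supported_on D A) ->
    (forall A, A \in C -> A != 0%R -> d <= \rank A) -> nu_min D d <= \dim C ->
  ferrers_code D (nu_min D d) d C.
Proof.
move=> d_gt0 fD sC dC le_dim; have [j lt_jd nuj] := nu_min_attained D d_gt0.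
have dimC : \dim C = nu D d j.
  by apply/eqP; rewrite eqn_leq -{2}nuj le_dim andbT; apply: singleton_bound.
split; rewrite ?nuj //; have [->|nu_gt0] := posnP (nu D d j); [by left|right].
split=> //.
have [/exists_inP[A AC /andP[A_neq0 /eqP rA]]|] :=
    boolP [exists (A : 'M[F]_n | A \in C), (A != 0%R) && (\rank A == d)].
  by exists A.
rewrite negb_exists_in => /forall_inP noA.
(* If rank [d] were missed, the bound for [d + 1] at the same index [j] would contradict
   [nu_succ_lt]. *)
suff dC1 A : A \in C -> A != 0%R -> d.+1 <= \rank A.
  have := singleton_bound fD sC dC1 (ltnW (lt_jd : j.+1 < d.+1)).
  by rewrite dimC leqNgt nu_succ_lt.
move=> AC A_neq0; rewrite ltn_neqAle dC // andbT eq_sym.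
by have := noA A AC; rewrite A_neq0.
Qed.

(** * Finite extensions and linearized polynomials *)

Local Open Scope ring_scope.

Lemma exists_frobenius (F : finFieldType) (L : splittingFieldType F) :
  exists s : gal_of {:L}, forall x, s x = x ^+ #|F|.
Proof.
have [a _ Da] := finField_galois_generator (sub1v {:L}%AS).
by exists a => x; rewrite Da ?memvf // dimv1 expn1.
Qed.

Lemma iter_frobenius (F : finFieldType) (L : splittingFieldType F)
    (s : 'AEnd(L)) (i : nat) (x : L) :
  (forall y, s y = y ^+ #|F|) -> iter i s x = x ^+ (#|F| ^ i).
Proof.
by move=> Ds; elim: i => [|i /= ->]; rewrite ?expr1 // Ds -exprM -expnSr.
Qed.

(** L is a splitting field of X^(Q^n) - X. The roots are distinct and form the field fixed by s^n,
    so they exhaust L, which thus has Q^n elements. *)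
Lemma exists_extension (F : finFieldType) (n : nat) : (0 < n)%N ->
  exists L : splittingFieldType F, \dim {:L} = n.
Proof.
move=> n_gt0; set Q := #|F|; have Q_gt1 : (1 < Q)%N := finNzRing_gt1 F.
have Qn_gt1 : (1 < Q ^ n)%N by rewrite (ltn_exp2l 0).
pose P (R : nzRingType) : {poly R} := 'X^(Q ^ n) - 'X.
have sizeP (R : nzRingType) : size (P R) = (Q ^ n).+1.
  by rewrite size_polyDl size_polyXn // size_polyN size_polyX.
have P_neq0 : P F != 0 by rewrite -size_poly_gt0 sizeP.
have [L [zs DP defL]] := FinSplittingFieldFor P_neq0.
rewrite rmorphB rmorphXn /= map_polyX -/(P L) in DP.
have [s Ds] := exists_frobenius L.
(* Since Q^n = 0 in L, the derivative of X^(Q^n) - X is the constant -1, and all roots are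
   simple. *)
have Uzs : uniq zs.
  have [p p_pr pcharF] := finPcharP F.
  have pcharL : p \in [pchar L] by rewrite pchar_lalg.
  have Q0 : (Q ^ n)%:R = 0 :> L.
    apply/eqP; rewrite -(dvdn_pcharf pcharL) Euclid_dvdX // n_gt0 andbT.
    move: Q_gt1; rewrite /Q (card_pprimeChar pcharF).
    by case: (logn _ _) => // k _; rewrite expnS dvdn_mulr.
  rewrite -separable_prod_XsubC -(eqp_separable DP) unlock.
  rewrite derivB derivXn derivX -mulr_natr -polyC_natr Q0 mulr0 sub0r.
  by rewrite -scaleN1r coprimepZr ?coprimep1 // oppr_eq0 oner_neq0.
pose E := fixedSpace (s ^+ n)%g; have in_zs : zs =i E.
  move=> z; rewrite -root_prod_XsubC -(eqp_root DP) (sameP fixedSpaceP eqP).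
  rewrite /root !hornerE subr_eq0 -(iter_frobenius n z Ds) /=; congr (_ == z).
  elim: (n) => [|i IHi]; first by rewrite gal_id.
  by rewrite expgSr galM ?memvf //= IHi.
have fullE : E = {:L}%VS.
  apply/eqP; rewrite eqEsubv subvf -defL -[E]subfield_closed agenvS //.
  by rewrite subv_add sub1v; apply/span_subvP => z; rewrite in_zs.
exists L; apply/eqP; rewrite -(eqn_exp2l _ _ Q_gt1) -/Q.
have <- : #|{: finvect_type L}%VS| = (Q ^ \dim {:L})%N by rewrite card_vspace.
have /eq_card -> : {: finvect_type L}%VS =i zs.
  by move=> z; rewrite in_zs fullE memvf.
rewrite (card_uniqP _) //= -eqSS -(size_prod_XsubC _ id).
by rewrite -(eqp_size DP) sizeP.
Qed.

(** Only the degree bound of a linearized polynomial is recorded, not its additive shape: counting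
    roots needs nothing more. *)
Definition qpoly_fun (F : finFieldType) (L : fieldExtType F) (k : nat)
    (f : L -> L) : Prop :=
  exists2 P : {poly L}, (size P <= (#|F| ^ k).+1)%N & f =1 horner P.

Section QPolyFun.

Variables (F : finFieldType) (L : fieldExtType F).
Implicit Types (f g : L -> L) (k : nat) (a : L).

Lemma qpoly_fun_id : qpoly_fun 0 (@idfun L).
Proof. by exists 'X => [|x]; rewrite ?hornerX // size_polyX expn0. Qed.

Lemma qpoly_fun_leq k l f : (k <= l)%N -> qpoly_fun k f -> qpoly_fun l f.
Proof.
move=> le_kl [P sP fP]; exists P => //; apply: leq_trans sP _.
by rewrite ltnS leq_pexp2l // ltnW // finNzRing_gt1.
Qed.

Lemma qpoly_funM k a f : qpoly_fun k f -> qpoly_fun k (fun x => a * f x).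
Proof.
move=> [P sP fP]; exists (a *: P) => [|x]; last by rewrite hornerZ fP.
exact: leq_trans (size_scale_leq _ _) sP.
Qed.

Lemma qpoly_fun_sum k (I : finType) (f : I -> L -> L) :
  (forall i, qpoly_fun k (f i)) -> qpoly_fun k (fun x => \sum_i f i x).
Proof.
move=> fk; elim: (index_enum I) => [|i r [P sP fP]].
  exists 0 => [|x]; first by rewrite size_poly0.
  by rewrite big_nil horner0.
have [R sR fR] := fk i; exists (R + P) => [|x].
  by rewrite (leq_trans (size_polyD _ _)) // geq_max sR.
by rewrite big_cons hornerD fR fP.
Qed.

Lemma qpoly_fun_frobB k f :
  qpoly_fun k f -> qpoly_fun k.+1 (fun x => f x ^+ #|F| - f x).
Proof.
move=> [P sP fP]; exists (P ^+ #|F| - P) => [|x].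
  rewrite (leq_trans (size_polyD _ _)) // geq_max size_polyN; apply/andP; split.
    rewrite (leq_trans (size_poly_exp_leq _ _)) // ltnS expnSr leq_mul //.
    by rewrite -subn1 leq_subLR add1n.
  by rewrite (leq_trans sP) // ltnS leq_pexp2l // ltnW // finNzRing_gt1.
by rewrite hornerD hornerN horner_exp fP.
Qed.

(** The kernel consists of roots of [P], so |F|^(dim ker f) is at most the degree of [P]. *)
Lemma dim_lker_horner k (P : {poly L}) (f : 'End(L)) :
    P != 0 -> (size P <= (#|F| ^ k).+1)%N -> f =1 horner P ->
  (\dim (lker f) <= k)%N.
Proof.
move=> P_neq0 sP fP; rewrite -(leq_exp2l _ _ (finNzRing_gt1 F)).
rewrite -(@card_vspace F (finvect_type L)) cardE -ltnS.
set r : seq (finvect_type L) := enum _.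
apply: leq_trans (_ : size (r : seq L) < size P)%N sP.
apply: max_poly_roots => //; last exact: (@enum_uniq (finvect_type L)).
by apply/allP => x; rewrite (@mem_enum (finvect_type L)) memv_ker /= fP.
Qed.

Lemma dim_lker_qpoly k (f : 'End(L)) :
  qpoly_fun k f -> f != 0 -> (\dim (lker f) <= k)%N.
Proof.
move=> [P sP fP] f_neq0; apply: (dim_lker_horner _ sP fP).
apply: contraNneq f_neq0 => P0; apply/eqP/lfunP => x.
by rewrite fP P0 horner0 lfunE.
Qed.

End QPolyFun.

(** * The flag of kernels of the powers of the difference operator *)

Section Flag.

Variables (F : finFieldType) (L : fieldExtType F) (p m : nat) (s : 'AEnd(L)).
Hypotheses (pcharF : p \in [pchar F]) (dimL : \dim {:L} = (p ^ m)%N).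
Hypothesis Ds : forall x, s x = x ^+ #|F|.

Definition delta (i : nat) : 'End(L) := ((s : 'End(L)) - \1%VF) ^+ i.

Definition flag (i : nat) : {vspace L} := lker (delta i).

Lemma delta0 x : delta 0 x = x.
Proof. by rewrite /delta expr0 lfunE. Qed.

Lemma delta1 x : delta 1 x = x ^+ #|F| - x.
Proof. by rewrite /delta expr1 !lfun_simp Ds. Qed.

Lemma deltaD i j x : delta (i + j) x = delta i (delta j x).
Proof. by rewrite /delta addnC exprD lfun_mulE. Qed.

Lemma flagP i x : (x \in flag i) = (delta i x == 0).
Proof. by rewrite memv_ker. Qed.

Lemma delta_flag i j x : (x \in flag (i + j)) = (delta j x \in flag i).
Proof. by rewrite !flagP deltaD. Qed.

Lemma flag0 : flag 0 = 0%VS.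
Proof. by apply/vspaceP => x; rewrite flagP delta0 memv0. Qed.

Lemma flagS i j : (i <= j)%N -> (flag i <= flag j)%VS.
Proof.
move=> le_ij; apply/subvP => x; rewrite -(subnK le_ij) !flagP deltaD.
by move=> /eqP ->; rewrite linear0.
Qed.

(** In characteristic p, raising to the power p^h is additive on the commuting operators s and 1. *)
Lemma delta_pexp h x : delta (p ^ h) x = x ^+ (#|F| ^ (p ^ h)) - x.
Proof.
have -> : delta (p ^ h) = (s : 'End(L)) ^+ (p ^ h) - 1.
  have pE : p \in [pchar 'End(L)] by rewrite pchar_lalg.
  elim: h => [|h IH]; first by rewrite /delta !expr1.
  rewrite /delta expnSr !exprM -/(delta _) IH -!(pFrobenius_autE pE).
  by rewrite pFrobenius_autB_comm ?pFrobenius_aut1 //; apply: commr1.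
rewrite !lfun_simp; congr (_ - _); elim: (p ^ h)%N => [|i IH].
  by rewrite expr0 lfunE /= expr1.
by rewrite exprSr lfun_mulE IH Ds -exprM -expnSr.
Qed.

(** As n = p^m, the operator delta^n is x |-> x^|L| - x, which is zero on the finite field L. *)
Lemma flag_full : flag (\dim {:L}) = {:L}%VS.
Proof.
apply/vspaceP => x; rewrite flagP memvf dimL delta_pexp.
rewrite -[X in _ - X](@expf_card (FinFieldExtType L) x) -dimL.
rewrite -(@card_vspace F (finvect_type L)) (@eq_card _ _ predT) ?subrr ?eqxx //.
by move=> y; rewrite memvf.
Qed.

(** Induction on a + b: delta^q of a product is a sum of two products, each with one factor moved
    one block down. The power t = s^q preserves every block because t = 1 + delta^q. If a or b is 0
    the product is zero, so the truncated predecessor is harmless. *)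
Lemma flagM h a b x y : x \in flag (p ^ h * a) -> y \in flag (p ^ h * b) ->
  x * y \in flag (p ^ h * (a + b).-1).
Proof.
set q := (p ^ h)%N; pose t z := z ^+ (#|F| ^ q) : L.
have dE z : delta q z = t z - z by rewrite delta_pexp.
have tM u v : t (u * v) = t u * t v by rewrite /t exprMn.
have flagT c z : z \in flag (q * c) -> t z \in flag (q * c).
  rewrite !flagP => /eqP z0; rewrite -[t z](subrK z) -dE linearD /= z0 addr0.
  by rewrite -deltaD addnC deltaD z0 linear0.
have red c z : z \in flag (q * c.+1) -> delta q z \in flag (q * c).
  by rewrite mulnSr delta_flag.
have [k] := ubnP (a + b); elim: k a b x y => // k IH [|a] [|b] x y lt_k.
- by rewrite muln0 flag0 !memv0 => /eqP -> _; rewrite mul0r.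
- by rewrite muln0 flag0 !memv0 => /eqP -> _; rewrite mul0r mem0v.
- by rewrite muln0 flag0 !memv0 => _ /eqP ->; rewrite mulr0 mem0v.
rewrite addnS ltnS in lt_k.
move=> xa yb; rewrite addSn addnS /= mulnSr delta_flag dE tM.
(* The twisted Leibniz rule for delta^q. *)
have -> : t x * t y - x * y = delta q x * t y + x * delta q y.
  by rewrite !dE; ring.
apply: memvD.
  by have := IH a b.+1 _ _ _ (red _ _ xa) (flagT _ _ yb); rewrite addnS; apply.
by have := IH a.+1 b _ _ _ xa (red _ _ yb); rewrite addSn; apply.
Qed.

(** The kernel of delta consists of roots of X^|F| - X, so it has dimension at most 1, and each
    further power adds at most 1. Equality follows by rank-nullity, since delta^(n - i) maps L into
    V_i and has a kernel of dimension at most n - i. *)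
Lemma dim_flag i : (i <= \dim {:L})%N -> \dim (flag i) = i.
Proof.
have dim1 : (\dim (flag 1) <= 1)%N.
  apply: (@dim_lker_horner _ _ _ ('X^#|F| - 'X)).
  - rewrite -size_poly_gt0 size_polyDl size_polyXn // size_polyN size_polyX.
    by rewrite ltnS finNzRing_gt1.
  - rewrite size_polyDl size_polyXn ?expn1 // size_polyN size_polyX.
    by rewrite ltnS finNzRing_gt1.
  - by move=> x; rewrite delta1 !hornerE.
have dim_le j : (\dim (flag j) <= j)%N.
  elim: j => [|j IH]; first by rewrite flag0 dimv0.
  rewrite -(limg_ker_dim (delta j) (flag j.+1)) -addn1 leq_add //.
    by rewrite (leq_trans _ IH) // dimvS // capvSr.
  apply: leq_trans dim1; apply/dimvS/subvP => _ /memv_imgP[x xj ->].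
  by rewrite -delta_flag addnC.
move=> le_in; apply/eqP; rewrite eqn_leq dim_le /=.
rewrite -(leq_add2l (\dim {:L} - i)) subnK //.
rewrite -{1}(limg_ker_dim (delta (\dim {:L} - i)) {:L}) capfv.
apply: leq_add (dim_le _) _; apply/dimvS/subvP => _ /memv_imgP[x _ ->].
by rewrite -delta_flag subnKC // flag_full memvf.
Qed.


(** Let i be the largest index with a_i nonzero. If c <= i, then delta^i kills the sum and also its
    terms of index j < i, where the total exponent reaches n; but it turns the i-th term into a_i
    delta^(n - 1)(u), which is nonzero. *)
Lemma flag_triangular (u : L) (a : 'I_(\dim {:L}) -> F) (c : nat) :
    u \notin flag (\dim {:L}).-1 ->
    \sum_i a i *: delta ((\dim {:L}).-1 - i) u \in flag c ->
  forall i : 'I_(\dim {:L}), (c <= i)%N -> a i = 0.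
Proof.
move=> uP sum_c i0 le_ci0; apply/eqP/negPn/negP => ai0.
have [i ai max_i] := @arg_maxnP _ i0 (fun i => a i != 0) val ai0.
have le_ci : (c <= i)%N by apply: leq_trans le_ci0 (max_i _ ai0).
have : \sum_i a i *: delta ((\dim {:L}).-1 - i) u \in flag i.
  exact: subvP (flagS le_ci) _ sum_c.
rewrite flagP linear_sum (bigD1 i) //= big1 => [|j ne_ji].
  rewrite addr0 linearZ /= -deltaD subnKC ?scaler_eq0 ?negb_or -?flagP.
    by rewrite (negPf ai) (negPf uP).
  by rewrite -ltnS prednK // (leq_ltn_trans (leq0n i)).
rewrite linearZ /= -deltaD.
have [->|aj] := eqVneq (a j) 0; first exact: scale0r.
have lt_ji : (j < i)%N.
  by rewrite ltn_neqAle val_eqE ne_ji; apply: max_i.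
apply/eqP; rewrite scaler_eq0 (negPf aj) /= -flagP.
apply: (subvP (flagS (_ : (\dim {:L} <= _)%N)));
  last by rewrite flag_full memvf.
by have := ltn_ord j; lia.
Qed.

(** The basis is the orbit of one vector u outside V_(n - 1), ordered by e_i = delta^(n - 1 - i)(u).
    Triangularity gives freeness (with c = 0) and the vanishing of coordinates. *)
Lemma exists_flag_basis : exists e : (\dim {:L}).-tuple L,
  [/\ basis_of {:L} e, forall i : 'I_(\dim {:L}), e`_i \in flag i.+1
    & forall c x (i : 'I_(\dim {:L})),
        x \in flag c -> (c <= i)%N -> coord e i x = 0].
Proof.
have n_gt0 : (0 < \dim {:L})%N.
  by rewrite dimL expn_gt0 prime_gt0 // (pcharf_prime pcharF).
have [u uP] : exists u, u \notin flag (\dim {:L}).-1.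
  have /subvPn[u _ uP] : ~~ ({:L} <= flag (\dim {:L}).-1)%VS; last by exists u.
  apply/negP => /dimvS; rewrite dim_flag ?leq_pred //; lia.
pose e := [tuple delta ((\dim {:L}).-1 - i) u | i < \dim {:L}].
have eE (i : 'I_(\dim {:L})) : e`_i = delta ((\dim {:L}).-1 - i) u.
  by rewrite -tnth_nth tnth_mktuple.
have eB : basis_of {:L} e.
  rewrite basisEfree subvf size_tuple leqnn !andbT; apply/freeP => k k0 i.
  apply: (flag_triangular (c := 0) uP) => //.
  by under eq_bigr => j _ do rewrite -eE; rewrite k0 mem0v.
exists e; split=> // [i|c x i xc].
  rewrite eE -delta_flag.
  have -> : (i.+1 + ((\dim {:L}).-1 - i) = \dim {:L})%N.
    by have := ltn_ord i; lia.
  by rewrite flag_full memvf.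
apply: (flag_triangular (a := fun i => coord e i x) uP).
by under eq_bigr => j _ do rewrite -eE; rewrite -(coord_basis eB) ?memvf.
Qed.

(** In a basis adapted to the flag, mapping V_(j + 1) into V_c forces column j to vanish from row c
    on (indices from 0); the rank condition is transferred through the kernels. *)
Lemma matrix_code (D : {set 'I_(\dim {:L}) * 'I_(\dim {:L})})
    (C : {vspace 'End(L)}) (d : nat) :
    ferrers D ->
    (forall f, f \in C -> forall (j : 'I_(\dim {:L})) x,
       x \in flag j.+1 -> f x \in flag (colh D j.+1)) ->
    (forall f, f \in C -> f != 0 -> (\dim (lker f) + d <= \dim {:L})%N) ->
  exists C' : {vspace 'M[F]_(\dim {:L})},
    [/\ \dim C' = \dim C, forall A, A \in C' -> supported_on D A
      & forall A, A \in C' -> A != 0 -> (d <= \rank A)%N].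
Proof.
move=> fD sC dC; have [e [eB eF eC]] := exists_flag_basis.
(* [mxof] acts on row vectors; the transpose places the coordinates of f(e_j) in column j. *)
pose M (f : 'End(L)) := (passmx.mxof e e f)^T.
have M_lin : linear M by move=> a f g; rewrite /M passmx.mxof_linear linearP.
pose MM := GRing.isLinear.Build _ _ _ _ M M_lin.
pose ML : {linear 'End(L) -> 'M[F]_(\dim {:L})} := HB.pack M MM.
have M_eq0 f : (M f == 0) = (f == 0) by rewrite /M trmx_eq0 passmx.mxof_eq0.
exists (linfun ML @: C)%VS; split.
- apply/limg_dim_eq/eqP; rewrite -subv0; apply/subvP => f.
  by rewrite memv_cap memv_ker lfunE /= M_eq0 memv0 => /andP[].
- move=> _ /memv_imgP[f fC ->] i j ijD; rewrite lfunE /= !mxE /=.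
  rewrite ferrersE // -leqNgt in ijD.
  rewrite passmx.vecof_delta; apply: (eC _ _ _ _ ijD); exact: sC (eF j).
move=> _ /memv_imgP[f fC ->]; rewrite lfunE /= M_eq0 => f_neq0.
rewrite mxrank_tr; set A := passmx.mxof e e f.
rewrite -(leq_add2l (\dim (lker f))); apply: leq_trans (dC f fC f_neq0) _.
(* It remains to bound the dimension of the row kernel of [A] by that of ker f; the map [g] below
   embeds the former into the latter. *)
rewrite addnC -leq_subLR -mxrank_ker.
pose g v := passmx.vecof e (v *m row_base (kermx A)).
have g_lin : linear g.
  by move=> a x y; rewrite /g mulmxDl -scalemxAl passmx.vecof_linear.
pose gM := GRing.isLinear.Build _ _ _ _ g g_lin.
pose gL : {linear 'rV[F]_(\rank (kermx A)) -> L} := HB.pack g gM.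
have g_inj : lker (linfun gL) = 0%VS.
  apply/eqP; rewrite -subv0; apply/subvP => v.
  rewrite memv_ker lfunE /= passmx.vecof_eq0 // memv0 => vB0.
  rewrite -(inj_eq (row_free_inj (row_base_free (kermx A)))) mul0mx.
  exact: vB0.
have <- : \dim (limg (linfun gL)) = \rank (kermx A).
  by rewrite limg_dim_eq ?g_inj ?capv0 // dimvf /dim /= mul1n.
apply/dimvS/subvP => _ /memv_imgP[v _ ->]; rewrite memv_ker lfunE /=.
rewrite /g (passmx.hom_vecof e eB) passmx.vecof_eq0 // -mulmxA.
suff -> : row_base (kermx A) *m A = 0 by rewrite mulmx0.
by apply/sub_kermxP; rewrite eq_row_base.
Qed.

(** * Codes spanned by families of operators *)

Lemma qpoly_fun_delta i k (f : L -> L) :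
  qpoly_fun k f -> qpoly_fun (i + k) (fun x => delta i (f x)).
Proof.
move=> fk; elim: i => [|i [P sP dP]].
  by case: fk => P sP fP; exists P => // x; rewrite delta0.
have [R sR dR] := qpoly_fun_frobB (ex_intro2 _ _ P sP (frefl (horner P))).
by exists R => // x; rewrite -add1n deltaD delta1 dP -dR.
Qed.

(** Independence of whole families makes the sum direct; applied to families concentrated at one
    index, it makes each [phi i] injective on [U i]. *)
Lemma dim_sum_limg (vT : vectType F) (k : nat) (U : 'I_k -> {vspace L})
    (phi : 'I_k -> 'Hom(L, vT)) :
    (forall a, (forall i, a i \in U i) -> \sum_i phi i (a i) = 0 ->
       forall i, a i = 0) ->
  \dim (\sum_i phi i @: U i) = (\sum_i \dim (U i))%N.
Proof.
move=> indep.
have /directvP -> : directv (\sum_i phi i @: U i).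
  apply/directv_sum_independent => us usU sum0 i _.
  have /fin_all_exists2[a aU usE] j : exists2 x, x \in U j & us j = phi j x.
    exact/memv_imgP/usU.
  by rewrite usE (indep a) ?linear0 // -[RHS]sum0; apply: eq_bigr.
apply: eq_bigr => i _; apply/limg_dim_eq/eqP; rewrite -subv0; apply/subvP => x.
rewrite memv_cap memv_ker memv0 => /andP[xU /eqP x0].
have := indep (fun j => if j == i then x else 0) _ _ i; rewrite eqxx => -> //.
  by move=> j; case: eqP => [->|_]; rewrite ?mem0v.
by rewrite big1 // => j _; case: eqP => [->|_]; rewrite ?linear0.
Qed.

(** Common frame of both constructions. With k = n - d + 1 indices, a nonzero member has a kernel of
    dimension at most k - 1 = n - d, while independence makes the dimension of the code the sum of
    the [t i]. *)
Lemma family_code (D : {set 'I_(\dim {:L}) * 'I_(\dim {:L})}) (d k : nat)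
    (t : nat -> nat) (phi : nat -> 'Hom(L, 'End(L))) :
    ferrers D -> (0 < d)%N -> (0 < k)%N -> (k + d = (\dim {:L}).+1)%N ->
    (forall i, (i < k)%N -> (t i <= \dim {:L})%N) ->
    (forall i a, qpoly_fun i (phi i a)) ->
    (forall a : 'I_k -> L, (forall x, \sum_(i < k) phi i (a i) x = 0) ->
       forall i, a i = 0) ->
    (forall i a (j : 'I_(\dim {:L})) x, (i < k)%N -> a \in flag (t i) ->
       x \in flag j.+1 -> phi i a x \in flag (colh D j.+1)) ->
    (nu_min D d <= \sum_(i < k) t i)%N ->
  exists C : {vspace 'M[F]_(\dim {:L})}, ferrers_code D (nu_min D d) d C.
Proof.
move=> fD d_gt0 k_gt0 kd tn phiQ phi_indep phiD le_nu.
pose C := (\sum_(i < k) phi i @: flag (t i))%VS.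
have memC f : f \in C -> exists2 a : 'I_k -> L, forall i, a i \in flag (t i)
    & forall x, f x = \sum_(i < k) phi i (a i) x.
  move=> /memv_sumP[us usU ->].
  have /fin_all_exists2[a aU usE] (j : 'I_k) :
      exists2 x, x \in flag (t j) & us j = phi j x by exact/memv_imgP/usU.
  by exists a => // x; rewrite sum_lfunE; apply: eq_bigr => i _; rewrite usE.
have dimC : \dim C = (\sum_(i < k) t i)%N.
  rewrite /C dim_sum_limg => [|a _ /lfunP a0].
    by apply: eq_bigr => i _; rewrite dim_flag // tn.
  by apply: phi_indep => x; have := a0 x; rewrite sum_lfunE lfunE.
have [f fC j x xj|f fC f_neq0|C' [dimC' sC' dC']] := @matrix_code D C d fD _ _.
- have [a aU ->] := memC f fC; apply: memv_suml => i _.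
  exact: phiD (ltn_ord i) (aU i) xj.
- have [a aU fE] := memC f fC.
  suff : (\dim (lker f) <= k.-1)%N by lia.
  apply: dim_lker_qpoly f_neq0.
  have [i|P sP fP] := @qpoly_fun_sum F L k.-1 _ (fun i : 'I_k => phi i (a i)).
    by apply: qpoly_fun_leq (phiQ i (a i)); have := ltn_ord i; lia.
  by exists P => // x; rewrite fE -fP.
by exists C'; apply: ferrers_code_of_dim_geq => //; rewrite dimC' dimC.
Qed.

(** * The operators x |-> a delta^i(x) and x |-> delta^i(a x) *)

Definition lmul_delta (i : nat) (a : L) : 'End(L) := (amull a \o delta i)%VF.

Definition rmul_delta (i : nat) (a : L) : 'End(L) := (delta i \o amull a)%VF.

Fact lmul_delta_linear i : linear (lmul_delta i).
Proof.
move=> c a b; apply/lfunP => x; rewrite !lfun_simp /=.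
by rewrite mulrDl scalerAl.
Qed.
HB.instance Definition _ i := GRing.isLinear.Build _ _ _ _ (lmul_delta i)
  (lmul_delta_linear i).

Fact rmul_delta_linear i : linear (rmul_delta i).
Proof.
move=> c a b; apply/lfunP => x; rewrite !lfun_simp /=.
by rewrite mulrDl -scalerAl linearP.
Qed.
HB.instance Definition _ i := GRing.isLinear.Build _ _ _ _ (rmul_delta i)
  (rmul_delta_linear i).

Lemma lmul_deltaE i a x : linfun (lmul_delta i) a x = a * delta i x.
Proof. by rewrite !lfunE /= !lfunE. Qed.

Lemma rmul_deltaE i a x : linfun (rmul_delta i) a x = delta i (a * x).
Proof. by rewrite !lfunE /= !lfunE. Qed.

Lemma flag_strict i : (i < \dim {:L})%N ->
  exists2 x, x \in flag i.+1 & x \notin flag i.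
Proof.
move=> lt_in; have /subvPn : ~~ (flag i.+1 <= flag i)%VS; last by [].
by apply/negP => /dimvS; rewrite !dim_flag ?ltnn // ltnW.
Qed.

(** Induction on i: at a point of V_(i + 1) outside V_i, the terms of index above i vanish, and
    those below i vanish by induction. *)
Lemma lmul_delta_indep k (a : 'I_k -> L) : (k <= \dim {:L})%N ->
  (forall x, \sum_(i < k) a i * delta i x = 0) -> forall i, a i = 0.
Proof.
move=> le_kn a0 i; have [N] := ubnP (val i); elim: N i => // N IH i lt_iN.
have [x xi1 xi] := flag_strict (leq_trans (ltn_ord i) le_kn).
have := a0 x; rewrite (bigD1 i) //= big1 => [|j ne_ji].
  by rewrite addr0 => /eqP; rewrite mulf_eq0 -flagP (negPf xi) orbF => /eqP.
have [lt_ji|lt_ij|eq_ij] := ltngtP j i.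
- by rewrite IH ?mul0r // (leq_trans lt_ji).
- have := subvP (flagS lt_ij) x xi1; rewrite flagP => /eqP ->.
  exact: mulr0.
by rewrite (val_inj eq_ij) eqxx in ne_ji.
Qed.

Lemma rmul_delta_indep k (a : 'I_k -> L) : (k <= \dim {:L})%N ->
  (forall x, \sum_(i < k) delta i (a i * x) = 0) -> forall i, a i = 0.
Proof.
move=> le_kn a0 i; have [N] := ubnP (val i); elim: N i => // N IH i lt_iN.
have lt_in := leq_trans (ltn_ord i) le_kn.
have n_gt0 := leq_ltn_trans (leq0n i) lt_in.
(* Applying [delta (n - 1 - i)] leaves only the [i]-th term. *)
have aiP x : a i * x \in flag (\dim {:L}).-1.
  have := congr1 (delta ((\dim {:L}).-1 - i)) (a0 x).
  rewrite linear0 linear_sum (bigD1 i) //= big1 => [|j ne_ji].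
    by rewrite addr0 -deltaD subnK ?flagP => [->|] //; rewrite -ltnS prednK.
  have [lt_ji|lt_ij|eq_ij] := ltngtP j i;
    last by rewrite (val_inj eq_ij) eqxx in ne_ji.
    by rewrite IH ?mul0r ?linear0 // (leq_trans lt_ji).
  apply/eqP; rewrite -deltaD -flagP.
  apply: (subvP (flagS (_ : (\dim {:L} <= _)%N)));
  last by rewrite flag_full memvf.
  lia.
(* A nonzero a_i would give a_i L = L, which does not fit in the proper subspace V_(n - 1). *)
apply/eqP/negPn/negP => ai; have lt_n1 : ((\dim {:L}).-1 < \dim {:L})%N by lia.
have [x _ /negP[]] := flag_strict lt_n1.
by have := aiP ((a i)^-1 * x); rewrite mulrA divff // mul1r.
Qed.

End Flag.

(** * Blocks and growth of the columns *)

Local Open Scope nat_scope.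

Lemma sum_blocks (q N : nat) (G : nat -> nat) :
  \sum_(j < q * N) G (j %/ q) = q * \sum_(J < N) G J.
Proof.
have [->|q_gt0] := posnP q; first by rewrite big_ord0.
elim: N => [|N IH]; first by rewrite muln0 !big_ord0 muln0.
rewrite mulnSr big_split_ord /= IH big_ord_recr /= mulnDr; congr (_ + _).
rewrite (eq_bigr (fun _ => G N)) => [|k _].
  by rewrite sum_nat_const card_ord.
by rewrite mulnC divnMDl // divn_small ?addn0.
Qed.

(** The p-height groups columns in blocks counted from the right; as q divides n, these are also the
    blocks counted from the left. *)
Lemma contraction_blocks (p n : nat) (D : {set 'I_n * 'I_n}) :
    1 < p -> 0 < n -> let q := p ^ pheight p D in
  q * (n %/ q) = n /\
  forall j, j < n -> colh D j.+1 = q * colh (contraction p D) (j %/ q).+1.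
Proof.
move=> p_gt1 n_gt0 q; have p_gt0 := ltnW p_gt1.
have q_gt0 : 0 < q by rewrite expn_gt0 p_gt0.
have [/(height_condP _ _ p_gt0)[]] := pheightP D p_gt1 n_gt0.
rewrite -/q => q_n q_c blk _.
have qN : q * (n %/ q) = n by rewrite mulnC divnK.
split=> // j lt_jn; set N := n %/ q in qN *; set J := j %/ q.
have lt_JN : J < N by rewrite /J ltn_divLR // mulnC qN.
rewrite colh_contraction -/q; last by rewrite lt_JN.
have le_qJ : q * J.+1 <= n by rewrite -qN leq_mul2l lt_JN orbT.
rewrite [RHS]mulnC divnK; last by rewrite q_c // le_qJ muln_gt0 q_gt0.
have jE : j = J * q + j %% q := divn_eq j q.
have lt_jq : j %% q < q by rewrite ltn_mod.
have -> : j.+1 = n - (n - j.+1) by lia.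
have -> : q * J.+1 = n - (n - q * J.+1) by lia.
have nE : n = q * J.+1 + (N - J.+1) * q.
  by rewrite -{1}qN [(N - _) * q]mulnC -mulnDr subnKC.
(* Block J from the left is block N - J - 1 from the right. *)
by apply: (blk _ _ (N - J.+1)); rewrite ?mulSn ?mulnS in nE le_qJ *; lia.
Qed.

Section Columns.

Variables (N : nat) (D : {set 'I_N * 'I_N}).
Hypothesis fD : ferrers D.
Let c J := colh D J.+1.

(** A positive height rises by at least one per column until it reaches N, where it stays. This is
    the alternative required by [lmul_delta_flag]. *)
Lemma monotone_growth I J : monotone_diagram D -> I <= J < N -> 0 < c I ->
  c J = N \/ c I + (J - I) <= c J.
Proof.
move=> mD /andP[]; elim: J => [|J IH]; first by case: I => //; right; lia.
rewrite leq_eqVlt => /orP[/eqP <- _ _|]; first by right; lia.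
rewrite ltnS => le_IJ lt_JN cI.
have le_c : c J <= c J.+1 by apply: colh_mono => //; lia.
have le_N : c J.+1 <= N by apply: colh_leq.
case: (IH le_IJ (ltnW lt_JN) cI) => [cJ|cJ]; first by left; lia.
have [cN|cN] := eqVneq (c J) N; first by left; lia.
have : c J < c J.+1 by apply: mD; rewrite -/(c J); have := colh_leq D J.+1; lia.
by right; lia.
Qed.

(** Here r is the length of row N - I, counted from 1. If the row is nonempty and starts at column
    K0, then r = N - K0, and slope at most one between J and K0 gives N - I <= c J + (K0 - J). *)
Lemma convex_growth I J : convex_diagram D -> I < N -> J < N ->
    let r := \sum_(K < N) (N - I <= c K) in
  [\/ N - I <= c J, r = 0 | r + J <= c J + I].
Proof.
move=> vD lt_IN lt_JN r.
have [le_J|lt_J] := leqP (N - I) (c J); first by constructor 1.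
have slope K : J <= K < N -> c K <= c J + (K - J).
  move=> /andP[]; elim: K => [|K IH].
    by rewrite leqn0 => /eqP ->; rewrite leq_addr.
  rewrite leq_eqVlt => /orP[/eqP <- _|]; first by rewrite leq_addr.
  rewrite ltnS => le_JK lt_KN; have le_cK := IH le_JK (ltnW lt_KN).
  by have := vD K.+1 (lt_KN : 0 < K.+1 < N); rewrite -/(c _) -/(c K); lia.
have c_mono K K' : K <= K' < N -> c K <= c K' by move=> lt_K; apply: colh_mono.
have [/existsP exK|/existsPn noK] :=
    boolP [exists K : 'I_N, N - I <= c K]; last first.
  by constructor 2; apply: big1 => K _; rewrite (negPf (noK K)).
have {exK}exK : exists K, (K < N) && (N - I <= c K).
  by have [K cK] := exK; exists K; rewrite ltn_ord.
have [K0 /andP[lt_K0N cK0] min_K0] := ex_minnP exK.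
have lt_JK0 : J < K0.
  rewrite ltnNge; apply/negP => le_K0J.
  by have := c_mono K0 J; rewrite le_K0J lt_JN => /(_ isT); lia.
have rE : r = N - K0.
  rewrite /r -(sum_ord_interval K0 (leqnn N)); apply: eq_bigr => K _.
  rewrite ltn_ord andbT; congr nat_of_bool; apply/idP/idP => [cK|le_K0K].
    by apply: min_K0; rewrite ltn_ord.
  by apply: leq_trans cK0 _; apply: c_mono; rewrite le_K0K /=.
constructor 3.
by have := slope K0; rewrite (ltnW lt_JK0) lt_K0N => /(_ isT); lia.
Qed.

End Columns.

(** * The two families of codes *)

Section Support.

Variables (F : finFieldType) (L : fieldExtType F) (p m : nat) (s : 'AEnd(L)).
Hypotheses (pcharF : p \in [pchar F]%R) (dimL : \dim {:L} = p ^ m).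
Hypothesis Ds : forall x, s x = (x ^+ #|F|)%R.

Variables (h N : nat).
Hypothesis qN : p ^ h * N = \dim {:L}.
Let q := p ^ h.

Let q_gt0 : 0 < q.
Proof. by rewrite expn_gt0 prime_gt0 // (pcharf_prime pcharF). Qed.

Lemma flag_block j x : x \in flag s j.+1 -> x \in flag s (q * (j %/ q).+1).
Proof. by apply/subvP/flagS; rewrite mulnC; apply: ltn_ceil. Qed.

(** With I and J the blocks of i and j, delta^i takes y down to V_(q(J + 1 - I)), and [flagM] puts
    the product in V_(q(a + J - I)). *)
Lemma lmul_delta_flag (a b : nat) i j x y :
    x \in flag s (q * a) -> y \in flag s j.+1 ->
    (i %/ q <= j %/ q -> 0 < a -> b = N \/ a + (j %/ q - i %/ q) <= b) ->
  (x * delta s i y)%R \in flag s (q * b).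
Proof.
move=> xa /flag_block yj ab.
set I := i %/ q in ab *; set J := j %/ q in yj ab *.
have dy : delta s i y \in flag s (q * (J.+1 - I)).
  have le_q : q * J.+1 <= q * (J.+1 - I) + i.
    by have := leq_divM i q; rewrite -/I mulnBr; lia.
  by rewrite -delta_flag; apply: (subvP (flagS s le_q)).
have [a0|a_gt0] := posnP a.
  by move: xa; rewrite a0 muln0 flag0 memv0 => /eqP ->; rewrite mul0r mem0v.
have [le_IJ|lt_JI] := leqP I J; last first.
  move: dy; have -> : J.+1 - I = 0 by lia.
  by rewrite muln0 flag0 memv0 => /eqP ->; rewrite mulr0 mem0v.
case: (ab le_IJ a_gt0) => [->|le_ab].
  by rewrite qN (flag_full pcharF dimL Ds) memvf.
have le_q : q * (a + (J.+1 - I)).-1 <= q * b.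
  by rewrite leq_mul2l; apply/orP; right; lia.
exact: subvP (flagS s le_q) _ (flagM pcharF Ds xa dy).
Qed.

(** The claim amounts to x y lying in V_(qb + i). By [flagM] the product lies in V_(q(a + J)), J
    being the block of j; the first alternative makes qb + i at least n. *)
Lemma rmul_delta_flag (a b : nat) i j x y :
    x \in flag s (q * a) -> y \in flag s j.+1 -> i <= \dim {:L} ->
    [\/ N - i %/ q <= b, a = 0 | a + j %/ q <= b + i %/ q] ->
  delta s i (x * y)%R \in flag s (q * b).
Proof.
move=> xa /flag_block yj le_in; set I := i %/ q; set J := j %/ q in yj *.
have le_I : q * I <= i by rewrite mulnC leq_divM.
rewrite -delta_flag => -[le_b|a0|le_ab].
- have le_n : \dim {:L} <= q * b + i.
    by rewrite -qN -/q; have := leq_mul (leqnn q) le_b; rewrite mulnBr; lia.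
  apply: (subvP (flagS s le_n)).
  by rewrite (flag_full pcharF dimL Ds) memvf.
- by move: xa; rewrite a0 muln0 flag0 memv0 => /eqP ->; rewrite mul0r mem0v.
have le_qi : q * (a + J.+1).-1 <= q * b + i.
  by have := leq_mul (leqnn q) le_ab; rewrite addnS /= !mulnDr; lia.
exact: subvP (flagS s le_qi) _ (flagM pcharF Ds xa yj).
Qed.

End Support.

Section Codes.

Variables (F : finFieldType) (L : fieldExtType F) (p m : nat) (s : 'AEnd(L)).
Hypotheses (pcharF : p \in [pchar F]%R) (dimL : \dim {:L} = p ^ m).
Hypothesis Ds : forall x, s x = (x ^+ #|F|)%R.
Local Notation n := (\dim {:L}).

Let p_gt1 : 1 < p. Proof. exact: prime_gt1 (pcharf_prime pcharF). Qed.
Let n_gt0 : 0 < n. Proof. by rewrite dimL expn_gt0 ltnW. Qed.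

Lemma pmonotone_code (D : {set 'I_n * 'I_n}) (d : nat) :
    ferrers D -> pmonotone p D -> 1 <= d <= n ->
  exists C : {vspace 'M[F]_n}, ferrers_code D (nu_min D d) d C.
Proof.
move=> fD mD /andP[d_gt0 le_dn].
have [qN cE] := contraction_blocks D p_gt1 n_gt0.
have fD' := ferrers_contraction p fD.
apply: (@family_code F L p m s pcharF dimL Ds D d (n - d).+1
  (fun i => colh D i.+1) (fun i => linfun (lmul_delta s i))) => //.
- lia.
- by move=> i _; apply: colh_leq.
- move=> i a.
  have [P sP dP] := qpoly_funM a (qpoly_fun_delta Ds i (qpoly_fun_id L)).
  by exists P; rewrite addn0 // in sP *; move=> x; rewrite lmul_deltaE -dP.
- move=> a a0; apply: (lmul_delta_indep pcharF dimL Ds (a := a)); first by lia.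
  by move=> x; rewrite -[RHS](a0 x); apply: eq_bigr => i _; rewrite lmul_deltaE.
- move=> i a j x lt_i; have lt_in : i < n by lia.
  rewrite !cE // lmul_deltaE => aP xP.
  apply: (lmul_delta_flag pcharF dimL Ds qN aP xP) => le_IJ.
  apply: (monotone_growth fD' mD); rewrite le_IJ /=.
  by rewrite ltn_divLR ?expn_gt0 ?(ltnW p_gt1) // mulnC qN.
(* For j = d - 1 the terms of [nu] are the column heights themselves, over the first n - d + 1
   columns. *)
rewrite (leq_trans (nu_min_leq D (_ : d.-1 < d))) ?prednK // nuE.
have -> : n - d.-1 = (n - d).+1 by lia.
by apply: leq_sum => i _; lia.
Qed.

Lemma pconvex_code (D : {set 'I_n * 'I_n}) (d : nat) :
    ferrers D -> pconvex p D -> 1 <= d <= n ->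
  exists C : {vspace 'M[F]_n}, ferrers_code D (nu_min D d) d C.
Proof.
move=> fD vD /andP[d_gt0 le_dn].
have [qN cE] := contraction_blocks D p_gt1 n_gt0.
have fD' := ferrers_contraction p fD.
set q := p ^ pheight p D in qN cE *; set N := n %/ q in qN *.
have q_gt0 : 0 < q by rewrite expn_gt0 ltnW.
have div_lt j : j < n -> j %/ q < N by rewrite ltn_divLR // mulnC qN.
(* The length of row n - i, counted from 1; the indices i <= n - d cover rows d to n. *)
pose t i := \sum_(j < n) (n - i <= colh D j.+1).
have tE i : i < n ->
    t i = q * \sum_(K < N) (N - i %/ q <= colh (contraction p D) K.+1).
  move=> lt_in; pose G K := N - i %/ q <= colh (contraction p D) K.+1.
  (* With n = qN and c a contracted height, n - i <= qc iff N - c <= i / q: row lengths also come in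
     blocks of size q. *)
  rewrite -(sum_blocks q N G) qN; apply: eq_bigr => j _; rewrite cE //.
  by rewrite /G !leq_subLR addnC -leq_subLR -[X in X - _]qN -mulnBr
    mulnC -leq_divRL // leq_subLR addnC.
apply: (@family_code F L p m s pcharF dimL Ds D d (n - d).+1
  t (fun i => linfun (rmul_delta s i))) => //.
- lia.
- move=> i _; rewrite -[leqRHS]muln1 -[X in _ <= X * _]card_ord -sum_nat_const.
  by apply: leq_sum => j _; apply: leq_b1.
- move=> i a.
  have [P sP dP] := qpoly_fun_delta Ds i (qpoly_funM a (qpoly_fun_id L)).
  by exists P; rewrite addn0 // in sP *; move=> x; rewrite rmul_deltaE -dP.
- move=> a a0; apply: (rmul_delta_indep pcharF dimL Ds (a := a)); first by lia.
  by move=> x; rewrite -[RHS](a0 x); apply: eq_bigr => i _; rewrite rmul_deltaE.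
- move=> i a j x lt_i; have lt_in : i < n by lia.
  rewrite tE // cE // rmul_deltaE => aP xP.
  apply: (rmul_delta_flag pcharF dimL Ds qN aP xP (ltnW lt_in)).
  by apply: convex_growth fD' _ _ vD _ _; apply: div_lt.
(* Counted by columns instead of rows, the cells in rows d to n number [nu D d 0]. *)
rewrite (leq_trans (nu_min_leq D d_gt0)) // nuE subn0 exchange_big /=.
apply: leq_sum => j _.
rewrite (eq_bigr (fun i : 'I_(n - d).+1 =>
  (n - colh D j.+1 <= i) && (i < (n - d).+1) : nat)) => [|i _].
  by rewrite sum_ord_interval //; have := colh_leq D j.+1; lia.
by rewrite ltn_ord andbT !leq_subLR addnC.
Qed.

End Codes.

Local Open Scope ring_scope.

Theorem theorem4p2 (d m p n : nat) (hd : (0 < d)%N) (hm : (0 < m)%N)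
    (hp : prime p) (hn : n = (p ^ m)%N) (hdn : (1 <= d <= n)%N) :
  (forall D : {set 'I_n * 'I_n}, ferrers D -> pmonotone p D ->
     forall F : finFieldType, p \in [pchar F] ->
     exists C : {vspace 'M[F]_n}, ferrers_code D (nu_min D d) d C) /\
  (forall D : {set 'I_n * 'I_n}, ferrers D -> pconvex p D ->
     forall F : finFieldType, p \in [pchar F] ->
     exists C : {vspace 'M[F]_n}, ferrers_code D (nu_min D d) d C).
Proof.
have n_gt0 : (0 < n)%N by case/andP: hdn; apply: leq_trans.
split=> D fD mD F pcharF; have [L dimL] := exists_extension F n_gt0.
all: have [s Ds] := exists_frobenius L.
(* The codes are built for matrices of order [\dim {:L}], so [n] is replaced by this dimension
   throughout. *)
all: case: n / dimL hn hdn n_gt0 D fD mD => dimL le_dn _ D fD mD.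
  exact: (pmonotone_code (s := s) pcharF dimL Ds fD mD le_dn).
exact: (pconvex_code (s := s) pcharF dimL Ds fD mD le_dn).
Qed.
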